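(* Let $(X,T)$ be a topological dynamical system and $\rho\in\mathcal{M}(X,T)$. If $\rho$ has discrete spectrum, then the measure complexity of $(X,T,\rho)$ is sub-polynomial.
   Context: A topological dynamical system (t.d.s.) is a pair $(X,T)$ with $X$ a compact metrizable space and $T:X\to X$ a homeomorphism. $\mathcal{M}(X,T)$ is the set of $T$-invariant Borel probability measures on $X$. For $\rho\in\mathcal{M}(X,T)$, an eigenfunction is a nonzero $f\in L^2(X,\mathcal{B}_X,\rho)$ with $f\circ T=\lambda f$ for some $\lambda\in\mathbb{C}$. The measure $\rho$ has discrete spectrum if $L^2(X,\mathcal{B}_X,\rho)$ is spanned by its eigenfunctions, i.e. the closed linear span of the eigenfunctions is all of $L^2(X,\mathcal{B}_X,\rho)$. Measure complexity: let $d$ be a metric on $X$ compatible with the topology and $\rho\in\mathcal{M}(X,T)$. For $n\in\mathbb{N}$ put $\overline{d}_n(x,y)=\frac1n\sum_{i=0}^{n-1}d(T^ix,T^iy)$ and $B_{\overline{d}_n}(x,\epsilon)=\{y\in X:\overline{d}_n(x,y)<\epsilon\}$. For $\epsilon>0$ let $$S_n(d,\rho,\epsilon)=\min\Big\{m\in\mathbb{N}:\exists x_1,\dots,x_m\in X\text{ such that }\rho\Big(\bigcup_{i=1}^mB_{\overline{d}_n}(x_i,\epsilon)\Big)>1-\epsilon\Big\}.$$ For an increasing $U:\mathbb{N}\to[1,+\infty)$ with $U(n)\to+\infty$, the measure complexity of $(X,T,\rho)$ is weaker than $U(n)$ if $\liminf_{n\to\infty}S_n(d,\rho,\epsilon)/U(n)=0$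 for every $\epsilon>0$ (this does not depend on the choice of compatible metric $d$). The measure complexity of $(X,T,\rho)$ is sub-polynomial if it is weaker than $U_\tau(n)=n^\tau$ for every $\tau>0$. *)

(* Defs.v *)
From HB Require Import structures.
From mathcomp Require Import all_boot all_order all_algebra.
From mathcomp Require Import all_classical all_reals all_analysis.
From mathcomp Require Import complex.

Set Implicit Arguments.
Unset Strict Implicit.
Unset Printing Implicit Defensive.

Import Order.TTheory GRing.Theory Num.Theory.
Import numFieldNormedType.Exports.

Local Open Scope classical_set_scope.
Local Open Scope ring_scope.

Section topological_dynamics.
Context {R : realType} {X : ptopologicalType}.

Definition compatible_metric (d : X -> X -> R) : Prop :=
  [/\ forall x y, d x y = 0 <-> x = y,
      forall x y, d x y = d y x,
      forall x y z, d x z <= d x y + d y z &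
      forall x, nbhs x =
        filter_from [set e : R | 0 < e] (fun e => [set y | d x y < e])].

Definition homeomorphism (T : X -> X) : Prop :=
  continuous T /\
  exists S : X -> X, [/\ continuous S, cancel T S & cancel S T].

End topological_dynamics.

Definition metrizable (R : realType) (X : ptopologicalType) : Prop :=
  exists d : X -> X -> R, compatible_metric d.

Definition tds (R : realType) (X : ptopologicalType) (T : X -> X) : Prop :=
  [/\ compact [set: X], metrizable R X & homeomorphism T].

(* X with its Borel sigma-algebra.  Measurable types are pointed in the
   library; a space carrying a probability measure is nonempty, so working with
   a pointed X loses nothing. *)
Notation borel X := (g_sigma_algebraType (@open X)).

Definition invariant_probabilities {R : realType} {X : ptopologicalType}
    (T : X -> X) : set (probability (borel X) R) :=
  [set rho | forall A : set (borel X), measurable A ->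
     rho (T @^-1` A) = rho A].

Section discrete_spectrum.
Context {R : realType} {X : ptopologicalType}.
Variable rho : probability (borel X) R.
Implicit Types (T : X -> X) (f : X -> R[i]).

Definition L2norm f : \bar R :=
  ('N[rho]_(2%:E)[EFin \o (fun x : borel X => Normc.normc (f x))])%E.

(* An element of L^2 is represented by a function; the equalities between
   elements of L^2 below are therefore stated almost everywhere. *)
Definition L2 f : Prop :=
  [/\ measurable_fun [set: borel X] (fun x : borel X => complex.Re (f x)),
      measurable_fun [set: borel X] (fun x : borel X => complex.Im (f x)) &
      (L2norm f < +oo)%E].

Definition eigenfunction T f : Prop :=
  [/\ L2 f,
      ~ {ae rho, forall x : borel X, f x = 0} &
      exists lambda : R[i],
        {ae rho, forall x : borel X, f (T x) = lambda * f x}].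

Definition discrete_spectrum T : Prop :=
  forall f, L2 f -> forall e : R, 0 < e ->
  exists (m : nat) (c : 'I_m -> R[i]) (g : 'I_m -> X -> R[i]),
    (forall i, eigenfunction T (g i)) /\
    (L2norm (fun x => f x - \sum_(i < m) c i * g i x)%R < e%:E)%E.

End discrete_spectrum.

Section measure_complexity.
Context {R : realType} {X : ptopologicalType}.
Implicit Types (T : X -> X) (d : X -> X -> R) (rho : probability (borel X) R).

Definition dbar T d (n : nat) (x y : X) : R :=
  n%:R^-1 * \sum_(0 <= i < n) d (iter i T x) (iter i T y).

Definition dbar_ball T d (n : nat) (x : X) (e : R) : set X :=
  [set y | dbar T d n x y < e].

Definition covering_sizes T d rho (n : nat) (e : R) : set nat :=
  [set m | (0 < m)%N /\ exists x : 'I_m -> X,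
     ((1 - e)%:E < rho (\bigcup_i dbar_ball T d n (x i) e))%E].

(* The minimum of a set of natural numbers, written as an infimum in \bar R
   (it is attained as soon as the set is nonempty). *)
Definition span_number T d rho (n : nat) (e : R) : \bar R :=
  ereal_inf [set (m%:R : R)%:E | m in covering_sizes T d rho n e].

(* The condition does not depend on the compatible metric, so it is asked of
   all of them.  The value at n = 0 is junk and is not seen by the liminf. *)
Definition complexity_weaker T rho (U : nat -> R) : Prop :=
  forall d, compatible_metric d -> forall e : R, 0 < e ->
    limn_einf (fun n => span_number T d rho n e * ((U n)^-1)%:E)%E = 0%E.

Definition sub_polynomial_complexity T rho : Prop :=
  forall tau : R, 0 < tau -> complexity_weaker T rho (fun n => n%:R `^ tau).

End measure_complexity.

(* Main.v *)
Require Import Defs.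
From mathcomp Require Import all_boot all_order all_algebra.
From mathcomp Require Import all_classical all_reals all_analysis.
From mathcomp Require Import measurable_realfun complex ring lra.

(** The covering numbers are in fact bounded in [n] for every [e], which is
    stronger than sub-polynomial growth.

    Write [gap_n f x y] for the average over [i < n] of
    [|f (T^i x) - f (T^i y)|].  If [phi] is an eigenfunction, invariance of
    the measure forces its eigenvalue to have modulus one, so for almost all
    [x] and [y] the gap equals [|phi x - phi y|], for all [n > 0]: one finite
    partition of the values of [phi], off a set of small measure, serves all
    [n] at once ([bounded_complexity_mean_gap_eigenfunction]).  This survives
    finite linear combinations.  It also survives approximation in L^1: the
    orbit averages of [|f - g|] have at most the same integral as [|f - g|],
    so by Markov's inequality they are small off a small set
    ([bounded_complexity_mean_gap_approx]).  Discrete spectrum therefore gives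
    the bound for the gap of every L^2 function ([L2_mean_gap]).

    Finally the metric is controlled by finitely many functions: if [s] is a
    finite net at scale [eta], then [d x y] is at most the sum over [z] in [s]
    of [|d z x - d z y|], plus [2 eta] ([metric_le_net]).  Averaging along
    orbits bounds [dbar] by the gaps of the functions [d z]
    ([bounded_complexity_dbar]), and choosing one point in each cell of the
    resulting finite partition gives a cover by balls whose size does not
    depend on [n] ([span_number_bounded]).  A bounded sequence divided by
    [n^tau] tends to zero. *)

Set Implicit Arguments.
Unset Strict Implicit.
Unset Printing Implicit Defensive.

Import Order.TTheory GRing.Theory Num.Theory.
Import numFieldNormedType.Exports.

Local Open Scope classical_set_scope.
Local Open Scope ring_scope.

(** * Families of two-point functions with bounded complexity *)

Section bounded_complexity.
Context {R : realType} {disp : measure_display} {Y : measurableType disp}.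
Variable P : probability Y R.
Implicit Types (D : nat -> Y -> Y -> R) (h : Y -> R).

(** [D] plays the role of a sequence of pseudometrics, and [code] names the
    cells of a partition of [G] into sets of [D n]-diameter less than [e].  The
    essential point is the order of the quantifiers: the set [C] of names is
    chosen before [n].  Codes are used instead of centres of balls so that two
    families can be added by pairing their codes. *)
Definition bounded_complexity D := forall e : R, 0 < e ->
  exists C : finType, forall n, exists (G : set Y) (code : Y -> C),
    [/\ measurable G, (P (~` G) < e%:E)%E &
        forall x y, G x -> G y -> code x = code y -> D n x y < e].

Lemma probability_setCI_lt (G H : set Y) (a b : R) :
  measurable G -> measurable H ->
  (P (~` G) < a%:E)%E -> (P (~` H) < b%:E)%E ->
  (P (~` (G `&` H)) < (a + b)%:E)%E.
Proof.
move=> mG mH Ga Hb; rewrite setCI EFinD.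
apply: (le_lt_trans (measureU2 _ _ _)); [exact: measurableC..|].
by rewrite lteD.
Qed.

(** The comparison with [D'] may hold up to [e] and off a small set depending
    on [n]; this is the form in which both almost sure identities and Markov's
    inequality are used below. *)
Lemma bounded_complexity_approx D :
  (forall e : R, 0 < e -> exists D',
     bounded_complexity D' /\
     forall n, exists G : set Y,
       [/\ measurable G, (P (~` G) < e%:E)%E &
           forall x y, G x -> G y -> D n x y <= D' n x y + e]) ->
  bounded_complexity D.
Proof.
move=> DD' e e0; have e20 : 0 < e / 2 by rewrite divr_gt0.
have [D' [/(_ _ e20)[C hC] hG]] := DD' _ e20.
exists C => n.
have [G [code [mG PG GD']]] := hC n.
have [H [mH PH HD]] := hG n.
exists (G `&` H), code; split.
- exact: measurableI.
- by rewrite [e]splitr; exact: probability_setCI_lt.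
- move=> x y [Gx Hx] [Gy Hy] xy.
  by rewrite (le_lt_trans (HD _ _ Hx Hy))// [ltRHS]splitr ltrD2r GD'.
Qed.

Lemma bounded_complexity_le D D' :
  (forall n x y, D n x y <= D' n x y) ->
  bounded_complexity D' -> bounded_complexity D.
Proof.
move=> DD' D'b; apply: bounded_complexity_approx => e e0; exists D'; split => //.
move=> n; exists setT; split => //.
  by rewrite setCT measure0 lte_fin.
by move=> x y _ _; rewrite (le_trans (DD' n x y))// lerDl ltW.
Qed.

Lemma bounded_complexityD D D' :
  bounded_complexity D -> bounded_complexity D' ->
  bounded_complexity (fun n x y => D n x y + D' n x y).
Proof.
move=> Db D'b e e0; have e20 : 0 < e / 2 by rewrite divr_gt0.
have [C hC] := Db _ e20; have [C' hC'] := D'b _ e20.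
exists (C * C')%type => n.
have [G [code [mG PG GD]]] := hC n.
have [H [code' [mH PH HD]]] := hC' n.
exists (G `&` H), (fun x => (code x, code' x)); split.
- exact: measurableI.
- by rewrite [e]splitr; exact: probability_setCI_lt.
- move=> x y [Gx Hx] [Gy Hy] [xy xy'].
  by rewrite [ltRHS]splitr ltrD ?GD ?HD.
Qed.

Lemma bounded_complexity0 : bounded_complexity (fun _ _ _ => 0).
Proof.
move=> e e0; exists unit => n; exists setT, (fun=> tt); split => //.
by rewrite setCT measure0 lte_fin.
Qed.

Lemma bounded_complexity_sum (I : Type) (s : seq I)
    (D : I -> nat -> Y -> Y -> R) :
  (forall i, bounded_complexity (D i)) ->
  bounded_complexity (fun n x y => \sum_(i <- s) D i n x y).
Proof.
move=> Db; elim: s => [|i s ih].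
  apply: bounded_complexity_le bounded_complexity0 => n x y.
  by rewrite big_nil.
apply: bounded_complexity_le (bounded_complexityD (Db i) ih) => n x y.
by rewrite big_cons.
Qed.

(** The scale [e / (c + 1)] makes [c * D n x y] small, and the minimum with [e]
    keeps the exceptional set smaller than [e]. *)
Lemma bounded_complexityZ (c : R) D : 0 <= c ->
  bounded_complexity D -> bounded_complexity (fun n x y => c * D n x y).
Proof.
move=> c0 Db e e0.
have c1 : 0 < c + 1 by rewrite ltr_wpDl.
have e'0 : 0 < Num.min e (e / (c + 1)) by rewrite lt_min e0 divr_gt0.
have [C hC] := Db _ e'0; exists C => n.
have [G [code [mG PG GD]]] := hC n.
exists G, code; split => //.
  by rewrite (lt_le_trans PG)// lee_fin ge_min lexx.
move=> x y Gx Gy /(GD _ _ Gx Gy); rewrite lt_min => /andP[_].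
rewrite ltr_pdivlMr// mulrC mulrDl mul1r => De.
have [D0|D0] := leP 0 (D n x y); first by rewrite (le_lt_trans _ De)// lerDl.
by rewrite (le_lt_trans _ e0)// mulr_ge0_le0// ltW.
Qed.

(** Continuity from above: the sets where [|h|] is at least [M] decrease to
    the empty set. *)
Lemma exists_bound_in_probability h : measurable_fun setT h ->
  forall e : R, 0 < e -> exists M : nat,
    let A := [set x | `|h x| < M%:R] in
    measurable A /\ (P (~` A) < e%:E)%E.
Proof.
move=> mh e e0.
have mA (n : nat) : measurable [set x | `|h x| < n%:R].
  have mnh : measurable_fun setT (fun x => `|h x|) by exact: measurableT_comp.
  have := mnh measurableT `]-oo, n%:R[%classic (measurable_itv _).
  by rewrite setTI; congr measurable; apply/seteqP; split => x /=; rewrite in_itv.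
pose F n := ~` [set x | `|h x| < n%:R].
have F0 : P (F n) @[n --> \oo] --> P (\bigcap_n F n).
  apply: nonincreasing_cvg_mu => //.
  - by rewrite (le_lt_trans (probability_le1 P _)) ?ltry//; exact: measurableC.
  - by move=> i; exact: measurableC.
  - by apply: bigcapT_measurable => i; exact: measurableC.
  - move=> i j ij; apply/subsetPset => x; apply: contra_not => /= hx.
    by rewrite (lt_le_trans hx)// ler_nat.
rewrite (_ : \bigcap_n F n = set0) in F0; last first.
  apply/seteqP; split => // x /(_ (Num.truncn `|h x|).+1 I).
  by apply; exact: truncnS_gt.
rewrite measure0 in F0.
have [] := F0 [set y | (y < e%:E)%E].
  by apply: open_nbhs_nbhs; split; [exact: open_ereal_lt_ereal|rewrite /= lte_fin].
by move=> M _ /(_ M (leqnn M)) FM; exists M.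
Qed.

(** On the set where [|h| < M], the code of [x] is the interval of length [e]
    of a subdivision of [-M, M] that contains [h x]. *)
Lemma bounded_complexity_value h : measurable_fun setT h ->
  bounded_complexity (fun _ x y => `|h x - h y|).
Proof.
move=> mh e e0; have [M [mM PM]] := exists_bound_in_probability mh e0.
(* [q x] is the index of the interval containing [h x]; on the good set it is
   at most [N], so that [inord] does not truncate it. *)
pose q x := Num.truncn ((h x + M%:R) / e).
pose N := Num.truncn ((2 * M%:R) / e).
exists 'I_N.+1 => n.
exists [set x | `|h x| < M%:R], (fun x => inord (q x)); split => // x y /=.
move=> hx hy /(congr1 val) /=.
have hM z : `|h z| < M%:R ->
    (q z < N.+1)%N /\ (q z)%:R <= (h z + M%:R) / e < (q z).+1%:R.
  rewrite ltr_norml => /andP[h1 h2]; split.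
    by rewrite ltnS le_truncn// ler_pM2r ?invr_gt0// mulr2n mulrDl !mul1r lerD2r ltW.
  by rewrite truncn_itv// divr_ge0 ?(ltW e0)//; lra.
have [qxN qxP] := hM x hx; have [qyN] := hM y hy.
rewrite !inordK// => + xy; move: qxP.
rewrite -xy -natr1 !ler_pdivlMr// !ltr_pdivrMr// ltr_norml.
by move=> /andP[a1 a2] /andP[b1 b2]; apply/andP; split; lra.
Qed.

End bounded_complexity.
(** * Complex-valued measurable functions *)

Section complex_valued.
Context {R : realType} {disp : measure_display} {Y : measurableType disp}.
Implicit Types (f g : Y -> R[i]).

Definition complex_measurable f :=
  measurable_fun setT (fun x => complex.Re (f x)) /\
  measurable_fun setT (fun x => complex.Im (f x)).

Lemma normcE (z : R[i]) :
  Normc.normc z = Num.sqrt ((complex.Re z) ^+ 2 + (complex.Im z) ^+ 2).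
Proof. by case: z. Qed.

Lemma normc_ge0 (z : R[i]) : 0 <= Normc.normc z.
Proof. by rewrite normcE sqrtr_ge0. Qed.

Lemma normc_le_ReIm (z : R[i]) :
  Normc.normc z <= `|complex.Re z| + `|complex.Im z|.
Proof.
rewrite normcE -[leRHS]ger0_norm ?addr_ge0// -sqrtr_sqr ler_wsqrtr//.
by rewrite sqrrD !real_normK ?num_real// lerD2r lerDl mulrn_wge0// mulr_ge0.
Qed.

Lemma normc_real_sub (a b : R) : Normc.normc (a%:C%C - b%:C%C) = `|a - b|.
Proof. by rewrite -rmorphB /= expr0n /= addr0 sqrtr_sqr. Qed.

Lemma normc_sum (I : Type) (s : seq I) (F : I -> R[i]) :
  Normc.normc (\sum_(i <- s) F i) <= \sum_(i <- s) Normc.normc (F i).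
Proof.
elim: s => [|i s ih]; first by rewrite !big_nil Normc.normc0.
by rewrite !big_cons (le_trans (le_normcD _ _))// lerD2l.
Qed.

Lemma measurable_normc f : complex_measurable f ->
  measurable_fun setT (fun x => Normc.normc (f x)).
Proof.
move=> [fr fi].
rewrite [X in measurable_fun _ X](_ : _ = Num.sqrt \o
    (fun x => (complex.Re (f x)) ^+ 2 + (complex.Im (f x)) ^+ 2)); last first.
  by apply/funext => x /=; rewrite normcE.
apply: measurableT_comp.
  by apply: continuous_measurable_fun; exact: sqrt_continuous.
by apply: measurable_funD; exact: measurable_funX.
Qed.

Lemma complex_measurableB f g : complex_measurable f -> complex_measurable g ->
  complex_measurable (fun x => f x - g x).
Proof.
move=> [fr fi] [gr gi]; split.
  rewrite [X in measurable_fun _ X](_ : _ =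
      (fun x => complex.Re (f x) - complex.Re (g x))).
    exact: measurable_funB.
  by apply/funext => x; case: (f x) (g x) => ? ? [].
rewrite [X in measurable_fun _ X](_ : _ =
    (fun x => complex.Im (f x) - complex.Im (g x))).
  exact: measurable_funB.
by apply/funext => x; case: (f x) (g x) => ? ? [].
Qed.

Lemma complex_measurableZ (c : R[i]) f : complex_measurable f ->
  complex_measurable (fun x => c * f x).
Proof.
move=> [fr fi]; case: c => a b; split.
  rewrite [X in measurable_fun _ X](_ : _ =
      (fun x => a * complex.Re (f x) - b * complex.Im (f x))).
    by apply: measurable_funB; exact: measurable_funM.
  by apply/funext => x; case: (f x).
rewrite [X in measurable_fun _ X](_ : _ =
    (fun x => a * complex.Im (f x) + b * complex.Re (f x))).
  by apply: measurable_funD; exact: measurable_funM.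
by apply/funext => x; case: (f x).
Qed.

Lemma complex_measurable_sum (I : Type) (s : seq I) (F : I -> Y -> R[i]) :
  (forall i, complex_measurable (F i)) ->
  complex_measurable (fun x => \sum_(i <- s) F i x).
Proof.
move=> mF; split.
  under eq_fun do rewrite raddf_sum.
  by apply: measurable_sum => i; have [] := mF i.
under eq_fun do rewrite raddf_sum.
by apply: measurable_sum => i; have [] := mF i.
Qed.

End complex_valued.

(** * Averages along the orbits of a measure-preserving map *)

Section invariant_measure.
Context {R : realType} {disp : measure_display} {Y : measurableType disp}.
Variables (P : probability Y R) (T : Y -> Y).
Hypothesis mT : measurable_fun setT T.
Hypothesis invT : forall A, measurable A -> P (T @^-1` A) = P A.
Implicit Types (f g phi : Y -> R[i]) (h : Y -> R).

Lemma measurable_iter i : measurable_fun setT (iter i T).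
Proof. by elim: i => [|i ih]; [exact: measurable_id|exact: measurableT_comp]. Qed.

Lemma invariant_iter i A : measurable A -> P (iter i T @^-1` A) = P A.
Proof.
elim: i A => // i ih A mA.
rewrite (_ : iter i.+1 T @^-1` A = iter i T @^-1` (T @^-1` A))//.
by rewrite ih ?invT// -[_ @^-1` _]setTI; exact: mT.
Qed.

Lemma integral_iter i h : measurable_fun setT h -> (forall x, 0 <= h x) ->
  (\int[P]_x (h (iter i T x))%:E = \int[P]_x (h x)%:E)%E.
Proof.
move=> mh h0.
have := @ge0_integral_pushforward _ _ _ _ _ _ (measurable_iter i) P setT
  (EFin \o h) measurableT _ _.
rewrite preimage_setT /= => <-.
- apply: eq_measure_integral => [|mTi A mA _]; first exact: measurable_iter.
  exact: invariant_iter.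
- exact/measurable_EFinP.
- by move=> x _; rewrite lee_fin.
Qed.

Lemma ae_iter i (Q : Y -> Prop) :
  {ae P, forall x, Q x} -> {ae P, forall x, Q (iter i T x)}.
Proof.
move=> [A [mA A0 QA]]; exists (iter i T @^-1` A); split.
- by rewrite -[_ @^-1` _]setTI; apply: (measurable_iter i).
- by rewrite invariant_iter.
- by move=> x; exact: QA.
Qed.

Definition orbit_average n h x := n%:R^-1 * \sum_(0 <= i < n) h (iter i T x).

Definition mean_gap f n x y :=
  n%:R^-1 * \sum_(0 <= i < n) Normc.normc (f (iter i T x) - f (iter i T y)).

Lemma measurable_orbit_average n h : measurable_fun setT h ->
  measurable_fun setT (orbit_average n h).
Proof.
move=> mh; apply: measurable_funM => //; apply: measurable_sum => i.
exact: (measurableT_comp mh (measurable_iter i)).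
Qed.

Lemma orbit_average_ge0 n h x : (forall x, 0 <= h x) -> 0 <= orbit_average n h x.
Proof. by move=> h0; rewrite mulr_ge0 ?invr_ge0// sumr_ge0. Qed.

(** By invariance each term of the average has the integral of [h].  There is
    equality for positive [n]; for [n = 0] the average is the zero function. *)
Lemma integral_orbit_average_le n h : measurable_fun setT h ->
  (forall x, 0 <= h x) ->
  (\int[P]_x (orbit_average n h x)%:E <= \int[P]_x (h x)%:E)%E.
Proof.
move=> mh h0.
have hi0 : (0 <= \int[P]_x (h x)%:E)%E.
  by apply: integral_ge0 => x _; rewrite lee_fin.
have mhi i : measurable_fun setT (fun x => (h (iter i T x))%:E).
  by apply/measurable_EFinP; exact: (measurableT_comp mh (measurable_iter i)).
rewrite (_ : \int[P]_x (orbit_average n h x)%:E =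
    (n%:R^-1 : R)%:E * \sum_(0 <= i < n) \int[P]_x (h x)%:E)%E; last first.
  under [in LHS]eq_integral do rewrite EFinM -sumEFin.
  rewrite ge0_integralZl_EFin ?invr_ge0//.
  - rewrite ge0_integral_sum//; last by move=> i x _; rewrite lee_fin.
    by congr (_ * _)%E; apply: eq_bigr => i _; exact: integral_iter.
  - by move=> x _; apply: sume_ge0 => i _; rewrite lee_fin.
  - exact: emeasurable_sum.
have [->|n0] := posnP n; first by rewrite big_geq// mule0.
move: hi0; case: (\int[P]_x (h x)%:E)%E => [r||]// r0; last by rewrite leey.
rewrite sumEFin sumr_const_nat subn0 -EFinM lee_fin -[X in _ * X]mulr_natl.
by rewrite mulrA mulVf ?mul1r// pnatr_eq0 -lt0n.
Qed.

Lemma markov_lt h (e : R) : 0 < e -> measurable_fun setT h ->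
  (forall x, 0 <= h x) -> (\int[P]_x (h x)%:E < (e * e)%:E)%E ->
  let A := [set x | h x < e] in
  measurable A /\ (P (~` A) < e%:E)%E.
Proof.
move=> e0 mh h0 he A.
have mA : measurable A.
  have := mh measurableT `]-oo, e[%classic (measurable_itv _).
  by rewrite setTI; congr measurable; apply/seteqP; split => x /=; rewrite in_itv.
split => //.
have := @le_integral_comp_abse _ _ _ P _ measurableT (EFin \o h) e id
  (@measurable_id _ _ _) (fun _ => id) (fun _ _ _ _ => id) _ e0.
move/(_ (proj2 (measurable_EFinP _ _) mh)); rewrite setTI.
rewrite (_ : [set x | _] = ~` A); last first.
  apply/seteqP; split => x /=; rewrite lee_fin ger0_norm// => hx.
    by apply/negP; rewrite -leNgt.
  by rewrite leNgt; apply/negP.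
under eq_integral do rewrite /= ger0_norm//.
move=> /le_lt_trans /(_ he); rewrite EFinM lte_pmul2l//.
Qed.

Lemma mean_gap_approx f g n x y : mean_gap f n x y <= mean_gap g n x y +
  (orbit_average n (fun z => Normc.normc (f z - g z)) x +
   orbit_average n (fun z => Normc.normc (f z - g z)) y).
Proof.
rewrite /mean_gap /orbit_average -!mulrDr ler_wpM2l ?invr_ge0//.
rewrite -!big_split /= ler_sum// => i _.
set a := iter i T x; set b := iter i T y.
rewrite (_ : f a - f b = g a - g b + ((f a - g a) + - (f b - g b))); last first.
  by ring.
rewrite (le_trans (le_normcD _ _))// lerD2l (le_trans (le_normcD _ _))//.
by rewrite normcN.
Qed.

(** If [|f - g|] has integral below [(e / 2) ^ 2], so have all its orbit
    averages, hence for each [n] these are below [e / 2] off a set of measure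
    less than [e / 2]; there the gaps of [f] and [g] differ by at most [e]. *)
Lemma bounded_complexity_mean_gap_approx f : complex_measurable f ->
  (forall e : R, 0 < e -> exists g,
     [/\ complex_measurable g, bounded_complexity P (mean_gap g) &
         (\int[P]_x (Normc.normc (f x - g x))%:E < e%:E)%E]) ->
  bounded_complexity P (mean_gap f).
Proof.
move=> mf H; apply: bounded_complexity_approx => e e0.
have e20 : 0 < e / 2 by rewrite divr_gt0.
have [g [mg gb fg]] := H _ (mulr_gt0 e20 e20).
exists (mean_gap g); split => // n.
have mfg : measurable_fun setT (fun x => Normc.normc (f x - g x)).
  by apply: measurable_normc; exact: complex_measurableB.
have fg0 x : 0 <= Normc.normc (f x - g x) by exact: normc_ge0.
have [mA PA] := markov_lt e20 (measurable_orbit_average n mfg)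
  (fun x => orbit_average_ge0 n x fg0)
  (le_lt_trans (integral_orbit_average_le n mfg fg0) fg).
exists [set x | orbit_average n (fun z => Normc.normc (f z - g z)) x < e / 2].
split => //.
  by rewrite (lt_trans PA)// lte_fin [ltRHS]splitr ltrDl.
move=> x y /= xA yA; rewrite (le_trans (mean_gap_approx f g n x y))// lerD2l.
by rewrite [leRHS]splitr lerD// ltW.
Qed.

Lemma bounded_complexity_mean_gap_sum (I : Type) (s : seq I)
    (c : I -> R[i]) (F : I -> Y -> R[i]) :
  (forall i, bounded_complexity P (mean_gap (F i))) ->
  bounded_complexity P (mean_gap (fun x => \sum_(i <- s) c i * F i x)).
Proof.
move=> Fb.
apply: bounded_complexity_le (bounded_complexity_sum s
  (fun i => bounded_complexityZ (normc_ge0 (c i)) (Fb i))) => n x y.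
rewrite /mean_gap; under [leRHS]eq_bigr do rewrite mulrCA.
rewrite -mulr_sumr ler_wpM2l ?invr_ge0//.
under [leRHS]eq_bigr do rewrite mulr_sumr.
rewrite exchange_big ler_sum// => j _.
rewrite -sumrB (le_trans (normc_sum _ _))// ler_sum// => i _.
by rewrite -mulrBr Normc.normcM.
Qed.

(** The integral of [|phi|] is finite and nonzero; invariance says that it is
    unchanged when [phi] is composed with [T], the eigenvalue equation that it
    is multiplied by the modulus of [lambda]. *)
Lemma eigenvalue_normc phi (lambda : R[i]) : complex_measurable phi ->
  (\int[P]_x (Normc.normc (phi x))%:E < +oo)%E ->
  ~ {ae P, forall x, phi x = 0} ->
  {ae P, forall x, phi (T x) = lambda * phi x} ->
  Normc.normc lambda = 1.
Proof.
move=> mphi phioo phi0 phiT.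
have mn := measurable_normc mphi.
have I0 : (0 <= \int[P]_x (Normc.normc (phi x))%:E)%E.
  by apply: integral_ge0 => x _; rewrite lee_fin normc_ge0.
have In0 : (\int[P]_x (Normc.normc (phi x))%:E != 0)%E.
  apply/eqP => I0'; apply: phi0.
  have /(ae_eq_integral_abs P measurableT) : measurable_fun setT
    (EFin \o (fun x => Normc.normc (phi x))) by exact/measurable_EFinP.
  case=> + _; under eq_integral do rewrite /= ger0_norm ?normc_ge0//.
  move=> /(_ I0'); apply: filterS => x /= /(_ I) [].
  exact: Normc.eq0_normc.
have : (\int[P]_x (Normc.normc (phi x))%:E =
    (Normc.normc lambda)%:E * \int[P]_x (Normc.normc (phi x))%:E)%E.
  rewrite -ge0_integralZl_EFin ?normc_ge0//; last 2 first.
  - by move=> x _; rewrite lee_fin normc_ge0.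
  - exact/measurable_EFinP.
  rewrite -[LHS](integral_iter 1 mn (fun x => normc_ge0 _)).
  apply: ge0_ae_eq_integral => //.
  - by apply/measurable_EFinP; exact: (measurableT_comp mn mT).
  - by apply/measurable_EFinP; exact: measurable_funM.
  - by move=> x _; rewrite lee_fin normc_ge0.
  - by move=> x _; rewrite lee_fin mulr_ge0 ?normc_ge0.
  - by apply: filterS phiT => x /= -> _; rewrite Normc.normcM.
move: I0 In0 phioo; case: (\int[P]_x _)%E => // r _ r0 _.
by rewrite -EFinM => -[] /esym; rewrite -[RHS]mul1r => /mulIf; apply.
Qed.

(** Almost surely [phi (T^i x) = lambda^i phi x] for all [i], and [lambda] has
    modulus one, so the gap does not depend on [n > 0] and is controlled by the
    real and imaginary parts of [phi]. *)
Lemma bounded_complexity_mean_gap_eigenfunction phi (lambda : R[i]) :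
  complex_measurable phi ->
  (\int[P]_x (Normc.normc (phi x))%:E < +oo)%E ->
  ~ {ae P, forall x, phi x = 0} ->
  {ae P, forall x, phi (T x) = lambda * phi x} ->
  bounded_complexity P (mean_gap phi).
Proof.
move=> mphi phioo phi0 phiT.
have lambda1 := eigenvalue_normc mphi phioo phi0 phiT.
have [A [mA A0 phiA]] : {ae P, forall x, forall i,
    phi (T (iter i T x)) = lambda * phi (iter i T x)}.
  by apply: ae_foralln => i; exact: (ae_iter i phiT).
have [mr mi] := mphi.
have Db := bounded_complexityD (bounded_complexity_value P mr)
                               (bounded_complexity_value P mi).
apply: bounded_complexity_approx => e e0; eexists; split; first exact: Db.
move=> n; exists (~` A); split; first exact: measurableC.
  by rewrite setCK A0 lte_fin.
have phi_iter x i : (~` A) x -> phi (iter i T x) = lambda ^+ i * phi x.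
  move=> /(subsetC phiA); rewrite setCK => phix.
  elim: i => [|i ih]; first by rewrite mul1r.
  by rewrite iterS phix ih exprS mulrA.
move=> x y Ax Ay; apply: ler_wpDr; first exact: ltW.
apply: (@le_trans _ _ (Normc.normc (phi x - phi y))); last first.
  rewrite (le_trans (normc_le_ReIm _))//.
  by case: (phi x) (phi y) => ? ? [].
rewrite /mean_gap (eq_bigr (fun=> Normc.normc (phi x - phi y))); last first.
  move=> i _; rewrite !phi_iter// -mulrBr Normc.normcM.
  suff -> : Normc.normc (lambda ^+ i) = 1 by rewrite mul1r.
  by elim: i => [|i ih]; rewrite ?Normc.normc1// exprS Normc.normcM lambda1 ih mul1r.
rewrite sumr_const_nat subn0.
have [->|n0] := posnP n; first by rewrite mulr0n mulr0 normc_ge0.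
by rewrite -[X in _ * X]mulr_natl mulrA mulVf ?mul1r// pnatr_eq0 -lt0n.
Qed.

(** Hoelder's inequality against the constant function 1, on a space of total
    mass 1. *)
Lemma integral_normc_le_L2 f : complex_measurable f ->
  (\int[P]_x (Normc.normc (f x))%:E <=
   'N[P]_(2%:E)[EFin \o (fun x => Normc.normc (f x))])%E.
Proof.
move=> mf.
have := @hoelder _ _ _ P (fun x => Normc.normc (f x)) (cst 1) 2 2
  (measurable_normc mf) (@measurable_cst _ _ _ _ _ _).
rewrite (_ : EFin \o cst 1 = cst 1%E)// Lnorm_cst1.
rewrite [X in (X `^ _)%E](_ : _ = 1%E) ?poweR1r ?mule1; last first.
  exact: probability_setT.
rewrite Lnorm1; under eq_integral do
  rewrite /= mulr1 ger0_norm ?normc_ge0//.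
apply => //; lra.
Qed.

End invariant_measure.
(** * Compatible metrics *)

Section compatible_metric.
Context {R : realType} {X : ptopologicalType}.
Variable d : X -> X -> R.
Hypothesis hd : compatible_metric d.

Lemma metric_ge0 x y : 0 <= d x y.
Proof.
have [d0 ds dt _] := hd; have := dt x y x.
by rewrite (ds y x) (proj2 (d0 x x) erefl); lra.
Qed.

(** By the triangle inequality [d x] is 1-Lipschitz for [d]. *)
Lemma metric_continuous x : continuous (d x).
Proof.
have [d0 ds dt dn] := hd.
move=> y; apply/cvgrPdist_lt => e e0.
suff : nbhs y [set z | `|d x y - d x z| < e] by [].
rewrite dn; exists e => //= z /= yz.
have := dt x y z; have := dt x z y; rewrite (ds z y) => a b.
by rewrite ltr_norml; apply/andP; split; lra.
Qed.

Lemma finite_net : compact [set: X] -> forall eta : R, 0 < eta ->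
  exists s : seq X, forall x, exists2 z, z \in s & d z x < eta.
Proof.
have [d0 ds dt dn] := hd.
rewrite compact_cover => cX eta eta0.
have [||s _ sX] := cX X setT (fun z => d z @^-1` [set r | r < eta]).
- move=> z _; apply: open_comp; last exact: open_lt.
  by move=> x _; exact: metric_continuous.
- by move=> x _; exists x => //=; rewrite (proj2 (d0 x x) erefl).
exists (finmap.enum_fset s) => x; have [z /= zs] := sX x I.
by exists z.
Qed.

End compatible_metric.

(** * Borel measurability of continuous maps *)

Section borel.
Context {R : realType} {X : ptopologicalType}.

Lemma borel_measurable_map (T : X -> X) : continuous T ->
  measurable_fun [set: borel X] (T : borel X -> borel X).
Proof.
move=> cT; apply: (@measurability _ _ (borel X) (borel X) setT T (@open X)) => // _ [A oA <-].
rewrite setTI; apply: sub_sigma_algebra.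
by apply: open_comp => // x _; exact: cT.
Qed.

Lemma borel_measurable_continuous (f : X -> R) : continuous f ->
  measurable_fun [set: borel X] (f : borel X -> R).
Proof.
move=> cf; apply: (@measurability _ _ (borel X) R setT f (@RGenOInfty.G R)).
  exact: RGenOInfty.measurableE.
move=> _ [_ [a ->] <-].
rewrite setTI; apply: sub_sigma_algebra.
by apply: open_comp; [move=> x _; exact: cf|exact: interval_open].
Qed.

Lemma L2_bounded (rho : probability (borel X) R) (h : X -> R) (M : R) :
  continuous h -> (forall x, `|h x| <= M) -> L2 rho (fun x => (h x)%:C%C).
Proof.
move=> ch hM; split => /=.
- exact: borel_measurable_continuous.
- exact: measurable_cst.
rewrite /L2norm unlock; apply: poweR_lty.
have M0 : 0 <= M by exact: le_trans (hM point).
have mh : measurable_fun [set: borel X] (h : borel X -> R).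
  exact: borel_measurable_continuous.
rewrite (eq_integral (fun x : borel X => (h x ^+ 2)%:E)); last first.
  move=> x _; rewrite /= expr0n /= addr0 sqrtr_sqr normr_id.
  by rewrite powR_mulrn// real_normK ?num_real.
apply: (@le_lt_trans _ _ (\int[rho]_x (M ^+ 2)%:E)%E).
  apply: ge0_le_integral => //.
  - by move=> x _; rewrite lee_fin sqr_ge0.
  - by apply/measurable_EFinP; exact: measurable_funX.
  - by move=> x _; rewrite lee_fin -real_normK ?num_real// ler_sqr ?nnegrE.
rewrite integral_cst//.
by rewrite [X in (_ * X)%E](_ : _ = 1%E) ?mule1 ?ltry//; exact: probability_setT.
Qed.

End borel.

(** * Discrete spectrum bounds the covering numbers *)

Section complexity.
Context {R : realType} {X : ptopologicalType}.
Variables (T : X -> X) (rho : probability (borel X) R).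
Hypothesis cT : continuous T.
Hypothesis invT : invariant_probabilities T rho.
Implicit Types (f : X -> R[i]).

Lemma L2_complex_measurable f : L2 rho f -> complex_measurable (f : borel X -> R[i]).
Proof. by case. Qed.

Lemma L2_mean_gap f : discrete_spectrum rho T -> L2 rho f ->
  bounded_complexity rho (@mean_gap R _ (borel X) T f).
Proof.
move=> spec L2f; have mT := borel_measurable_map cT.
apply: (bounded_complexity_mean_gap_approx mT invT (L2_complex_measurable L2f)).
move=> e e0; have [m [c [g [eig fg]]]] := spec f L2f e e0.
have mg i : complex_measurable (g i : borel X -> R[i]).
  by have [/L2_complex_measurable] := eig i.
have mcg : complex_measurable
    (fun x : borel X => \sum_(i < m) c i * g i x).
  by apply: complex_measurable_sum => i; exact: complex_measurableZ.
exists (fun x : borel X => \sum_(i < m) c i * g i x); split => //.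
- apply: (@bounded_complexity_mean_gap_sum _ _ (borel X)) => i.
  have [L2g g0 [lambda glambda]] := eig i.
  apply: (bounded_complexity_mean_gap_eigenfunction mT invT (mg i) _ g0 glambda).
  apply: (le_lt_trans (integral_normc_le_L2 rho (mg i))).
  by case: L2g.
- apply: le_lt_trans fg; apply: integral_normc_le_L2.
  by apply: complex_measurableB => //; exact: L2_complex_measurable.
Qed.

Variable d : X -> X -> R.
Hypothesis hd : compatible_metric d.

(** If [z] is within [eta] of [x], then
    [d x y <= d z x + d z y <= 2 d z x + |d z x - d z y|]. *)
Lemma metric_le_net (s : seq X) (eta : R) x y :
  (exists2 z, z \in s & d z x < eta) ->
  d x y <= \sum_(z <- s) `|d z x - d z y| + 2 * eta.
Proof.
have [d0 ds dt dn] := hd; move=> [z zs zx].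
have := dt x z y; rewrite (ds x z) => xy.
have : `|d z x - d z y| <= \sum_(z <- s) `|d z x - d z y|.
  by rewrite (big_rem z)//= lerDl sumr_ge0.
have : d z y - d z x <= `|d z x - d z y| by rewrite distrC ler_norm.
by lra.
Qed.

(** The functions [d z] are continuous and bounded, hence in L^2, so their gaps
    have bounded complexity; [metric_le_net] averaged along the orbits of [x]
    and [y] compares [dbar] with a finite sum of such gaps. *)
Lemma bounded_complexity_dbar : compact [set: X] -> discrete_spectrum rho T ->
  bounded_complexity rho (fun n (x y : borel X) => dbar T d n x y).
Proof.
move=> cX spec; have [d0 ds dt dn] := hd.
have [s1 hs1] := finite_net hd cX ltr01.
(* The bound comes from a net [s1] at scale 1: [x] is within 1 of some [w] in
   [s1], and [d z w] is at most the sum of all the [d z w]. *)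
have L2d z : L2 rho (fun x => (d z x)%:C%C).
  apply: (@L2_bounded _ _ _ _ (\sum_(w <- s1) d z w + 1)).
    exact: metric_continuous.
  move=> x; have [w ws wx] := hs1 x.
  rewrite ger0_norm ?metric_ge0// (le_trans (dt z w x))// lerD//; last exact: ltW.
  by rewrite (big_rem w)//= lerDl sumr_ge0// => v _; exact: metric_ge0.
apply: bounded_complexity_approx => e e0.
have e20 : 0 < e / 2 by rewrite divr_gt0.
have [s hs] := finite_net hd cX e20.
pose D n (x y : borel X) := \sum_(z <- s)
  @mean_gap R _ (borel X) T (fun x => (d z x)%:C%C) n x y.
exists D; split; first by apply: bounded_complexity_sum => z; exact: L2_mean_gap.
move=> n; exists setT; split => //; first by rewrite setCT measure0 lte_fin.
move=> x y _ _; rewrite /D /mean_gap -mulr_sumr exchange_big /= /dbar.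
apply: (@le_trans _ _ (n%:R^-1 * \sum_(0 <= i < n)
   (\sum_(z <- s) `|d z (iter i T x) - d z (iter i T y)| + 2 * (e / 2)))).
  rewrite ler_wpM2l ?invr_ge0// ler_sum// => i _.
  exact: metric_le_net.
rewrite big_split /= mulrDr lerD//.
  rewrite ler_wpM2l ?invr_ge0// ler_sum// => i _; rewrite ler_sum// => z _.
  by rewrite -normc_real_sub; exact: lexx.
rewrite sumr_const_nat subn0 (_ : 2 * (e / 2) = e); last by lra.
have [->|n0] := posnP n; first by rewrite mulr0n mulr0 ltW.
by rewrite -[X in _ * X]mulr_natl mulrA mulVf ?mul1r// pnatr_eq0 -lt0n.
Qed.

Lemma iter_continuous i : continuous (iter i T).
Proof.
elim: i => [|i ih] x; first exact: cvg_id.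
by apply: (@continuous_comp _ _ _ (iter i T) T); [exact: ih|exact: cT].
Qed.

Lemma open_dbar_ball n (x : X) (e : R) : open (dbar_ball T d n x e).
Proof.
apply: (@open_comp _ _ (dbar T d n x) [set r | r < e]); last exact: open_lt.
move=> y _; apply: cvgM; first exact: cvg_cst.
apply: (@cvg_big _ _ +%R _ _ add_continuous) => i _.
apply: (@continuous_comp _ _ _ (iter i T) (d (iter i T x))).
  exact: iter_continuous.
exact: metric_continuous.
Qed.

(** One centre is chosen in [G] for each code that occurs there; the balls
    around these centres cover [G]. *)
Lemma span_number_bounded (e : R) : 0 < e ->
  bounded_complexity rho (fun n (x y : borel X) => dbar T d n x y) ->
  exists K : nat, forall n, (span_number T d rho n e <= (K%:R)%:E)%E.
Proof.
move=> e0 /(_ _ e0)[C hC]; exists #|C| => n.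
have [G [code [mG PG GD]]] := hC n.
apply: ge_ereal_inf; exists (#|C|%:R)%:E => //.
exists #|C| => //; split.
  by apply/card_gt0P; exists (code point).
(* For a code that does not occur in [G] any centre will do. *)
have hx (c : C) : {x : X | forall y, G y -> code y = c -> dbar T d n x y < e}.
  have [/cid[x [Gx <-]]|nx] := pselect (exists x, G x /\ code x = c).
    by exists x => y Gy yx; apply: GD.
  by exists point => y Gy yc; exfalso; apply: nx; exists y.
exists (fun i => sval (hx (enum_val i))).
apply: (@lt_le_trans _ _ (rho G)).
  have : (rho (~` G) = 1 - rho G)%E by exact: probability_setC.
  move: PG => /[swap] ->.
  have : rho G \is a fin_num by exact: fin_num_measure.
  by case: (rho G) => // r _; rewrite -EFinB !lte_fin; lra.
apply: le_measure; rewrite ?inE//.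
  apply: sub_sigma_algebra; apply: bigcup_open => i _; exact: open_dbar_ball.
move=> y Gy; exists (enum_rank (code y)) => //=.
rewrite /dbar_ball /=; case: (hx _) => x /=; apply => //.
by rewrite enum_rankK.
Qed.

End complexity.

(** * Division by a power of n *)

Lemma cvg_powR_natV (R : realType) (tau : R) : 0 < tau ->
  (n%:R `^ tau)^-1 @[n --> \oo] --> (0 : R).
Proof.
move=> tau0; apply/cvgr0Pnorm_lt => e e0; near=> n.
have n0 : (0 : R) < n%:R `^ tau.
  by rewrite powR_gt0// ltr0n; near: n; exact: nbhs_infty_gt.
rewrite gtr0_norm ?invr_gt0// invf_plt ?posrE//.
have -> : e^-1 = (e^-1 `^ tau^-1) `^ tau.
  by rewrite -powRrM mulVf ?lt0r_neq0// powRr1// invr_ge0 ltW.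
rewrite gt0_ltr_powR ?nnegrE ?powR_ge0//.
by near: n; exact: nbhs_infty_gtr.
Unshelve. all: by end_near. Qed.

Theorem proposition4p1 (R : realType) (X : ptopologicalType) (T : X -> X)
    (rho : probability (borel X) R)
    (hT : tds R T)
    (hrho : invariant_probabilities T rho)
    (hspec : discrete_spectrum rho T) :
  sub_polynomial_complexity T rho.
Proof.
move=> tau tau0 d hd e e0; have [cX _ [cT _]] := hT.
have [K hK] := span_number_bounded cT hd e0
  (bounded_complexity_dbar cT hrho hd cX hspec).
suff /cvg_limn_einf_sup[] : (fun n => span_number T d rho n e *
  ((n%:R `^ tau)^-1)%:E)%E @ \oo --> 0%E by [].
apply: (@squeeze_cvge _ _ _ _ (cst 0%E) _
  (fun n => (K%:R * (n%:R `^ tau)^-1)%:E)).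
- apply: nearW => n; apply/andP; split.
    rewrite mule_ge0 ?lee_fin ?invr_ge0 ?powR_ge0//.
    by apply: le_ereal_inf_tmp => _ [m _ <-]; rewrite lee_fin.
  by rewrite EFinM lee_wpmul2r ?lee_fin ?invr_ge0 ?powR_ge0.
- exact: cvg_cst.
- apply: cvg_EFin; first exact: nearW.
  rewrite -[X in _ --> X](mulr0 K%:R).
  by apply: cvgM; [exact: cvg_cst|exact: cvg_powR_natV].
Qed.
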